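(* For all integers $k\ge 1$ and $n\ge 1$, the pyramid graph $Py(n)$ satisfies $$pa_k(Py(n))\ \ge\ si_k(Py(n))\ \ge\ \left\lceil\frac{2}{k+1}\,n\right\rceil .$$
   Context: Search model. Let $G$ be a finite directed acyclic (multi)graph with exactly one source. A sink is a vertex with no outgoing edge. A hidden set $E^*$ of edges contains exactly one outgoing edge of every non-sink vertex (and nothing else); following the edges of $E^*$ from the source yields a unique directed path $P(E^* )$ from the source to a sink. A question is a non-sink vertex $v$; its answer is the outgoing edge of $v$ that belongs to $E^*$. In each round up to $k$ questions are asked simultaneously; all answers of the round are then revealed, and later rounds may depend on the answers of earlier rounds. $pa_k(G)$ is the minimal number of rounds that suffices in the worst case (over all $E^*$, for a best deterministic strategy) to determine the path $P(E^* )$, and $si_k(G)$ is the minimal number of rounds that suffices in the worst case to determine the sink in which $P(E^* )$ ends. Pyramid graph $Py(n)$: its vertices lie on $n+1$ levels; for $1\le i\le n+1$ the $i$th level has the $i$ vertices $v_{i,1},\dots,v_{i,i}$. From every $v_{i,j}$ with $1\le i\le n$, $1\le j\le i$, there is one edge to $v_{i+1,j}$ and one edge to $v_{i+1,j+1}$, and there are no other edges. The source is $v_{1,1}$ and the sinks are the $n+1$ vertices of level $n+1$. *)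

(* Defs.v *)
From mathcomp Require Import all_boot.
From mathcomp Require Import boolp.

Set Implicit Arguments.
Unset Strict Implicit.
Unset Printing Implicit Defensive.

(* Edges form a type of their own, so parallel edges are allowed.  For [cycle],
   the empty sequence is a cycle and [:: v] is a cycle iff v carries a loop. *)
Record dag := Dag {
  vertex : finType;
  edge : finType;
  src : edge -> vertex;
  tgt : edge -> vertex;
  source : vertex;
  dag_acyclic : forall c : seq vertex,
    cycle (fun u v => [exists e, (src e == u) && (tgt e == v)]) c -> c = [::];
  dag_source : forall v, [forall e, tgt e != v] = (v == source)
}.

Section SearchModel.
Variable G : dag.
Implicit Types (S : {set edge G}) (Q : {set vertex G}) (p : seq (edge G)).

Definition is_sink (v : vertex G) := [forall e : edge G, src e != v].

Definition hidden S :=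
  [forall v : vertex G, ~~ is_sink v ==> (#|[set e in S | src e == v]| == 1)].

Fixpoint walk (u : vertex G) p :=
  if p is e :: p' then (src e == u) && walk (tgt e) p' else true.

Definition walk_end (u : vertex G) p := last u (map (@tgt G) p).

Definition is_hidden_path S p :=
  [&& walk (source G) p, all (mem S) p & is_sink (walk_end (source G) p)].

Definition is_hidden_sink S (w : vertex G) :=
  exists2 p, is_hidden_path S p & w = walk_end (source G) p.

(* The joint answer to the set Q of questions; when S is a hidden set and Q
   consists of non-sinks, it contains exactly one edge leaving each v in Q. *)
Definition answers S Q := [set e in S | src e \in Q].

Inductive strategy (O : Type) :=
  | Stop (out : O)
  | Ask (Q : {set vertex G}) (next : {set edge G} -> strategy O).

Fixpoint legal (O : Type) (k : nat) (st : strategy O) : Prop :=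
  match st with
  | Stop _ => True
  | Ask Q next =>
      [/\ #|Q| <= k, forall v, v \in Q -> ~~ is_sink v
        & forall a, legal k (next a)]
  end.

Fixpoint output (O : Type) S (st : strategy O) : O :=
  match st with
  | Stop out => out
  | Ask Q next => output S (next (answers S Q))
  end.

Fixpoint rounds (O : Type) S (st : strategy O) : nat :=
  match st with
  | Stop _ => 0
  | Ask Q next => (rounds S (next (answers S Q))).+1
  end.

Definition rounds_suffice (k : nat) (O : Type)
    (correct : {set edge G} -> O -> Prop) (r : nat) : Prop :=
  exists2 st : strategy O, legal k st &
    forall S, hidden S -> correct S (output S st) /\ rounds S st <= r.

Lemma walk_path u p : walk u p ->
  path (fun u v => [exists e : edge G, (src e == u) && (tgt e == v)])
    u (map (@tgt G) p).
Proof.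
elim: p u => //= e p IHp u /andP[/eqP <- /IHp ->]; rewrite andbT.
by apply/existsP; exists e; rewrite !eqxx.
Qed.

Lemma dag_path_uniq u (s : seq (vertex G)) :
  path (fun u v => [exists e : edge G, (src e == u) && (tgt e == v)]) u s ->
  uniq (u :: s).
Proof.
elim: s u => // v s IHs u us; rewrite cons_uniq.
have /andP[_ vs] := us; rewrite (IHs _ vs) andbT; apply/negP => u_s.
move: us; case/splitPr: u_s => p1 p2; rewrite -cat_rcons cat_path => /andP[c _].
by have := @dag_acyclic G (u :: p1) c.
Qed.

Lemma walk_size u p : walk u p -> size p < #|vertex G|.
Proof.
move=> /walk_path/dag_path_uniq/card_uniqP; rewrite /= size_map => <-.
exact: max_card.
Qed.

Lemma hidden_out S v : hidden S -> ~~ is_sink v ->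
  exists2 e, e \in S & src e = v.
Proof.
move=> /forallP/(_ v)/implyP/[apply]/cards1P[e De]; exists e;
  by have := set11 e; rewrite -De inE => /andP[? /eqP].
Qed.

Lemma hidden_out_uniq S e f : hidden S -> e \in S -> f \in S ->
  src e = src f -> e = f.
Proof.
move=> /forallP/(_ (src f))/implyP hS eS fS ef.
have /cards1P[g Dg] : #|[set e in S | src e == src f]| == 1.
  by apply: hS; rewrite negb_forall; apply/existsP; exists f; rewrite negbK.
have: e \in [set g] by rewrite -Dg inE eS ef eqxx.
have: f \in [set g] by rewrite -Dg inE fS eqxx.
by rewrite !inE => /eqP-> /eqP->.
Qed.

Lemma hidden_path_exists_unique S : hidden S ->
  exists! p, is_hidden_path S p.
Proof.
move=> hS.
have grow m : (exists p, is_hidden_path S p) \/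
    (exists p, [/\ walk (source G) p, all (mem S) p & size p = m]).
  elim: m => [|m [|[p [wp Sp szp]]]]; [by right; exists [::] | by left |].
  have [sk|nsk] := boolP (is_sink (walk_end (source G) p)).
    by left; exists p; rewrite /is_hidden_path wp Sp sk.
  have [e eS De] := hidden_out hS nsk.
  right; exists (rcons p e); split; last by rewrite size_rcons szp.
    elim: p (source G) wp {Sp szp nsk} De => [|f p IHp] u /=.
      by move=> _ ->; rewrite eqxx.
    by case/andP=> -> wp De; apply: IHp.
  by rewrite all_rcons Sp andbT.
have [p pP] : exists p, is_hidden_path S p.
  have [//|[p [/walk_size]]] := grow #|vertex G|.
  by move=> + _ szp; rewrite szp ltnn.
exists p; split=> // q; move: pP; rewrite /is_hidden_path.
elim: p (source G) q => [|e p IHp] u [|f q] //=.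
- by move=> sk /and3P[/andP[/eqP fu _] _ _]; move/forallP/(_ f): sk; rewrite fu eqxx.
- move=> /and3P[/andP[/eqP eu _] _ _] sk.
  by move/forallP/(_ e): sk; rewrite eu eqxx.
move=> /and3P[/andP[/eqP eu wp] /andP[eS Sp] sp].
move=> /and3P[/andP[/eqP fu wq] /andP[fS Sq] sq].
have ef : e = f by apply: hidden_out_uniq hS eS fS _; rewrite eu fu.
by subst f; congr (_ :: _); apply: (IHp (tgt e)); apply/and3P; split.
Qed.

(* Asking all non-sinks one at a time reveals the hidden set. *)
Fixpoint ask_all (O : Type) (f : {set edge G} -> O) (s : seq (vertex G))
    (known : {set edge G}) : strategy O :=
  if s is v :: s' then Ask [set v] (fun a => ask_all f s' (known :|: a))
  else Stop (f known).

Lemma rounds_suffice_exists (k : nat) (O : Type)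
    (correct : {set edge G} -> O -> Prop) :
  0 < k -> (forall S, exists o, hidden S -> correct S o) ->
  exists r, `[< rounds_suffice k correct r >].
Proof.
move=> k0 exf; have [f fP] := choice exf.
pose s := enum [set v : vertex G | ~~ is_sink v].
exists (size s); apply/asboolP; exists (ask_all f s set0).
  have: {in s, forall v, ~~ is_sink v} by move=> v; rewrite mem_enum inE.
  elim: s set0 => //= v s IHs known sP; split=> [|w|a].
  - by rewrite cards1.
  - by rewrite inE => /eqP->; apply: sP; rewrite mem_head.
  - by apply: IHs => w ws; apply: sP; rewrite inE ws orbT.
move=> S hS; split; last first.
  by elim: s set0 => //= v s IHs known; rewrite ltnS.
suff -> : output S (ask_all f s set0) = f S by exact: fP.
have -> : output S (ask_all f s set0) = f (set0 :|: [set e in S | src e \in s]).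
  elim: s set0 => [|v s IHs] known /=.
    by congr f; apply/setP => e; rewrite !inE andbF orbF.
  rewrite IHs; congr f; apply/setP => e; rewrite !inE.
  by rewrite -orbA -andb_orr.
congr f; apply/setP => e; rewrite !inE mem_enum inE /=.
case: (e \in S) => //=; rewrite negb_forall; apply/existsP; exists e.
by rewrite negbK.
Qed.

Lemma pa_exists k : 0 < k -> exists r, `[< rounds_suffice k is_hidden_path r >].
Proof.
move=> k0; apply: rounds_suffice_exists => // S.
have [/hidden_path_exists_unique[p [pP _]]|] := boolP (hidden S).
  by exists p.
by exists [::].
Qed.

Lemma si_exists k : 0 < k -> exists r, `[< rounds_suffice k is_hidden_sink r >].
Proof.
move=> k0; apply: rounds_suffice_exists => // S.
have [/hidden_path_exists_unique[p [pP _]]|] := boolP (hidden S).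
  by exists (walk_end (source G) p) => _; exists p.
by exists (source G).
Qed.

End SearchModel.

(* The minimum is only meaningful for k >= 1: with no questions allowed, no
   number of rounds suffices in general. *)
Definition pa (k : nat) (hk : 0 < k) (G : dag) : nat := ex_minn (pa_exists G hk).
Definition si (k : nat) (hk : 0 < k) (G : dag) : nat := ex_minn (si_exists G hk).
Arguments pa : clear implicits.
Arguments si : clear implicits.

Section Pyramid.
Variable n : nat.

(* The pair (i, j) stands for v_{i,j}, with 1 <= j <= i <= n + 1. *)
Definition py_vertex := {ij : 'I_n.+2 * 'I_n.+2 | 0 < ij.2 <= ij.1}.
Definition level (v : py_vertex) : nat := (val v).1.
Definition pos (v : py_vertex) : nat := (val v).2.

Definition py_edge := {uv : py_vertex * py_vertex |
  (level uv.2 == (level uv.1).+1) &&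
  ((pos uv.2 == pos uv.1) || (pos uv.2 == (pos uv.1).+1))}.

Definition py_src (e : py_edge) : py_vertex := (val e).1.
Definition py_tgt (e : py_edge) : py_vertex := (val e).2.
Definition py_source : py_vertex := exist _ (inord 1, inord 1)
  (introT andP (conj (eq_leq (esym (inordK (isT : 1 < n.+2)))) (leqnn _))).

Lemma py_pos_bounds (v : py_vertex) : 0 < pos v <= level v.
Proof. exact: valP v. Qed.

Lemma py_acyclic (c : seq py_vertex) :
  cycle (fun u v => [exists e, (py_src e == u) && (py_tgt e == v)]) c ->
  c = [::].
Proof.
case: c => //= u c uc; have: path (relpre level ltn) u (rcons c u).
  apply: sub_path uc => v w /existsP[e /andP[/eqP <- /eqP <-]] /=.
  by have /andP[/eqP + _] := valP e; rewrite /py_tgt => ->.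
rewrite path_sortedE; last by move=> x y z; apply: ltn_trans.
by rewrite all_rcons /= ltnn.
Qed.

Lemma py_sourceP (v : py_vertex) :
  [forall e, py_tgt e != v] = (v == py_source).
Proof.
have /andP[v0 v1] := py_pos_bounds v.
have vn : level v < n.+2 by exact: ltn_ord.
apply/forallP/eqP => [noin|-> e]; last first.
  apply/eqP => e1; have /andP[/eqP + _] := valP e.
  rewrite -/(py_tgt e) e1 [LHS]inordK // => -[]/esym l0.
  by have := py_pos_bounds (val e).1; rewrite l0; case: pos.
have [l1|l1] := leqP (level v) 1.
  apply: val_inj; rewrite [val v]surjective_pairing; congr (_, _);
    apply: val_inj; rewrite /= inordK // -/(level v) -/(pos v); apply/eqP.
    by rewrite eqn_leq l1 (leq_trans v0).
  by rewrite eqn_leq v0 (leq_trans v1).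
pose i := (level v).-1; pose j := minn (pos v) i.
have Di : level v = i.+1 by rewrite prednK // ltnW.
have i0 : 0 < i by rewrite -ltnS -Di.
have iN : i < n.+2 by apply: leq_trans vn; rewrite Di ltnW.
have jN : j < n.+2 by apply: leq_ltn_trans iN; apply: geq_minr.
have uP : 0 < (inord j : 'I_n.+2) <= (inord i : 'I_n.+2).
  by rewrite !inordK // leq_min v0 i0 geq_minr.
pose u : py_vertex := exist _ (inord i, inord j) uP.
have lu : level u = i by rewrite /level /= inordK.
have pu : pos u = j by rewrite /pos /= inordK.
have eP : (level v == (level u).+1) &&
    ((pos v == pos u) || (pos v == (pos u).+1)).
  rewrite lu Di eqxx pu /j /minn; case: ltnP => [_|iv]; first by rewrite eqxx.
  by move: v1; rewrite Di leq_eqVlt ltnS => /orP[->|vi];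
    rewrite ?orbT // eqn_leq iv vi.
by have /eqP := noin (exist _ (u, v) eP).
Qed.

Definition Py : dag := Dag py_acyclic py_sourceP.

End Pyramid.

(* Main.v *)
Require Import Defs.
From mathcomp Require Import all_boot all_order all_algebra.
From mathcomp Require Import zify.

(** Adversary argument. Call the first vertex of the hidden path whose answer
    has not been revealed the current vertex. Every question at another vertex
    is answered "left". When the current vertex [s] is asked, its two children
    start vertical runs of already asked vertices, lying in adjacent columns
    and hence disjoint; the adversary enters the shorter run, of length [x], so
    at least [2 x] asked vertices drop out of the levels below the new current
    vertex. Thus twice the number of levels descended, plus the number of asked
    vertices on deeper levels, grows by at most [k + 1] per round, while the
    sink stays undetermined until the current vertex is itself a sink. *)

Set Implicit Arguments.
Unset Strict Implicit.
Unset Printing Implicit Defensive.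

(** * From path strategies to sink strategies *)

Section Output.
Variables (G : dag) (O O' : Type) (f : O -> O').

Fixpoint map_strategy (st : strategy G O) : strategy G O' :=
  match st with
  | Stop out => Stop G (f out)
  | Ask Q next => Ask Q (fun a => map_strategy (next a))
  end.

Lemma legal_map_strategy k st : legal k st -> legal k (map_strategy st).
Proof. by elim: st => //= Q next IH [cQ nQ lQ]; split=> // a; apply: IH. Qed.

Lemma output_map_strategy S st : output S (map_strategy st) = f (output S st).
Proof. by elim: st => /=. Qed.

Lemma rounds_map_strategy S st : rounds S (map_strategy st) = rounds S st.
Proof. by elim: st => //= Q next ->. Qed.

End Output.

(** Reporting the end of the path found turns a path strategy into a sink strategy with the same
    questions. *)
Lemma si_le_pa k (hk : 0 < k) G : si k hk G <= pa k hk G.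
Proof.
rewrite /si /pa; case: ex_minnP => s _ smin; case: ex_minnP => p + _.
move=> /boolp.asboolP[st lst cst]; apply: smin; apply/boolp.asboolP.
exists (map_strategy (walk_end (source G)) st); first exact: legal_map_strategy.
move=> S /cst[pS rS]; rewrite output_map_strategy rounds_map_strategy.
by split=> //; exists (output S st).
Qed.

(** * Hidden sets of the pyramid, encoded by their right turns *)

Section Adversary.
Variable n : nat.
Implicit Types (u v : py_vertex n) (T A Q : {set py_vertex n}).

Definition mk_vertex i j : py_vertex n :=
  insubd (py_source n) (inord i, inord j).

Lemma mk_vertexE i j : 0 < j <= i -> i <= n.+1 ->
  level (mk_vertex i j) = i /\ pos (mk_vertex i j) = j.
Proof.
move=> ij iN; have jN : j < n.+2 by lia.
have vP : 0 < (inord j : 'I_n.+2) <= (inord i : 'I_n.+2) by rewrite !inordK.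
by rewrite /level /pos val_insubd vP /= !inordK.
Qed.

Lemma py_vertex_eq u v : level u = level v -> pos u = pos v -> u = v.
Proof.
move=> l p; apply: val_inj; rewrite [val u]surjective_pairing.
by rewrite [val v]surjective_pairing; congr (_, _); apply: val_inj.
Qed.

Definition child (right : bool) v := mk_vertex (level v).+1 (pos v + right).

Lemma childE b v : level v <= n ->
  level (child b v) = (level v).+1 /\ pos (child b v) = pos v + b.
Proof. by move=> ln; apply: mk_vertexE; have := py_pos_bounds v; lia. Qed.

(* [T] is the set of vertices whose answer is "right". *)
Definition step T v := child (v \in T) v.
Definition hidden_of T : {set edge (Py n)} :=
  [set e : edge (Py n) | tgt e == step T (src e)].
(** The hidden path after [i] steps, meaningful for [i <= n] only: the default value in [mk_vertex]
    makes [step] send a sink back to the source. *)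
Definition node T i := iter i (step T) (py_source n).

Lemma level_src_le (e : edge (Py n)) : level (src e : py_vertex n) <= n.
Proof.
have /andP[/eqP le _] := valP e.
by have := ltn_ord (val (val e).2).1; rewrite -/(level _) le ltnS.
Qed.

Lemma level_tgt (e : edge (Py n)) :
  level (tgt e : py_vertex n) = (level (src e : py_vertex n)).+1.
Proof. by have /andP[/eqP] := valP e. Qed.

Lemma child_edge b v : level v <= n ->
  exists e : edge (Py n), src e = v /\ tgt e = child b v.
Proof.
move=> /(childE b)[l p].
have eP : (level (child b v) == (level v).+1) &&
    ((pos (child b v) == pos v) || (pos (child b v) == (pos v).+1)).
  by rewrite l p eqxx; case: (b); rewrite ?addn0 ?addn1 eqxx ?orbT.
by exists (exist _ (v, child b v) eP).
Qed.

Lemma py_is_sink v : @is_sink (Py n) v = (n < level v).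
Proof.
apply/forallP/idP => [sk|ln e]; last first.
  by apply: contraTneq ln => <-; rewrite -leqNgt level_src_le.
rewrite ltnNge; apply/negP => /(child_edge false)[e [se _]].
by have := sk e; rewrite se eqxx.
Qed.

Lemma hidden_hidden_of T : hidden (hidden_of T).
Proof.
apply/forallP => v; apply/implyP; rewrite py_is_sink -leqNgt => lv.
have [e [se te]] := child_edge (v \in T) lv.
apply/cards1P; exists e; apply/setP => f; rewrite !inE.
apply/andP/eqP => [[/eqP tf /eqP sf]|->]; last by rewrite te /step se !eqxx.
apply: val_inj; rewrite [val f]surjective_pairing [val e]surjective_pairing.
congr (_, _); first exact: etrans sf (esym se).
by apply: etrans tf _; rewrite sf /step -te.
Qed.

Lemma level_source : level (py_source n) = 1.
Proof. by rewrite /level /= inordK. Qed.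

Lemma walk_hidden_of T u (p : seq (edge (Py n))) :
  @walk (Py n) u p -> all (mem (hidden_of T)) p ->
  @walk_end (Py n) u p = iter (size p) (step T) u /\
  level (@walk_end (Py n) u p : py_vertex n) = level u + size p.
Proof.
elim: p u => [|e p IHp] u /=; first by rewrite addn0.
move=> /andP[/eqP <- wp] /andP[]; rewrite inE => /eqP te Sp.
have [pe pl] := IHp _ wp Sp.
rewrite /walk_end /= in pe pl *; rewrite pl level_tgt addSnnS; split=> //.
by rewrite pe -iterS iterSr; congr iter.
Qed.

(** All sinks lie on level [n + 1] and each edge descends one level, so a path from the source to a
    sink has exactly [n] edges. *)
Lemma hidden_sink_node T w : @is_hidden_sink (Py n) (hidden_of T) w ->
  w = node T n.
Proof.
case=> p /and3P[wp Sp]; rewrite py_is_sink.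
have [pe lw] := walk_hidden_of wp Sp.
rewrite lw level_source => ln ->; rewrite pe /node; congr iter.
have := ltn_ord (val (@walk_end (Py n) (py_source n) p : py_vertex n)).1.
by rewrite -/(level _) lw level_source; lia.
Qed.

Lemma nodeS T i : node T i.+1 = step T (node T i).
Proof. by []. Qed.

Lemma level_node T i : i <= n -> level (node T i) = i.+1.
Proof.
elim: i => [|i IHi] iN; first exact: level_source.
have li := IHi (ltnW iN).
by have [|-> _] := @childE (node T i \in T) (node T i); rewrite li.
Qed.

(** The first [i] steps read answers on levels up to [i] only. *)
Lemma node_setU1 v T i : i < level v -> i <= n -> node (v |: T) i = node T i.
Proof.
elim: i => [|i IHi] // iv iN; rewrite !nodeS IHi; try lia.
rewrite /step !inE; case: eqP => // nv.
by have := level_node T (ltnW iN); rewrite nv; lia.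
Qed.

(** * The two vertical runs below the current vertex *)

Section Turn.
Variables (T : {set py_vertex n}) (i : nat).
Hypotheses (i_lt_n : i < n) (T_level : forall v, v \in T -> level v <= i).

Let s := node T i.
Definition turn (b : bool) := if b then s |: T else T.

Lemma level_turn b v : v \in turn b -> level v <= i.+1.
Proof.
case: b => /=; last by move=> /T_level; lia.
rewrite !inE => /orP[/eqP->|/T_level]; last lia.
by rewrite level_node // ltnW.
Qed.

(** Going left keeps the position, and [turn b] has no vertex deeper than [s]. *)
Lemma pos_turn b j : i < j <= n -> pos (node (turn b) j) = pos s + b.
Proof.
have ls : level s = i.+1 by rewrite level_node // ltnW.
elim: j => // j IHj /andP[]; rewrite ltnS leq_eqVlt => /predU1P[<-|ij] jn.
  have -> : node (turn b) i.+1 = child b s; last first.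
    by have [|_ ->] := @childE b s; rewrite ?ls.
  have -> : node (turn b) i.+1 = step (turn b) s.
    by rewrite nodeS; case: (b); rewrite //= node_setU1 ?ls // ltnW.
  congr child; case: (b); rewrite /= ?setU11 //.
  by apply/negbTE/negP => /T_level; rewrite ls ltnn.
have lj := level_node (turn b) (ltnW jn).
have [|_] := @childE (node (turn b) j \in turn b) (node (turn b) j).
  by rewrite lj.
rewrite -/(step _ _) -nodeS => ->.
suff /negbTE-> : node (turn b) j \notin turn b.
  by rewrite addn0 IHj // ij ltnW.
by apply/negP => /level_turn; rewrite lj; lia.
Qed.

Definition below j A := [set v in A | j < level v].

(** Take for [x] the least depth at which one of the runs leaves [A]; it exists because the runs end
    in sinks, which are not in [A]. *)
Lemma turn_exists A : (forall v, v \in A -> level v <= n) ->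
  exists b x, [/\ i.+1 + x <= n, node (turn b) (i.+1 + x) \notin A
    & #|below (i.+1 + x).+1 A| + x.*2 <= #|below i.+1 A|].
Proof.
move=> A_level.
pose out x := (node (turn false) (i.+1 + x) \notin A) ||
              (node (turn true) (i.+1 + x) \notin A).
have ex_out : exists x, out x.
  exists (n - i.+1); apply/orP; left; apply/negP.
  by rewrite subnKC // => /A_level; rewrite level_node // ltnn.
case: (ex_minnP ex_out) => x outx xmin.
have xn : i.+1 + x <= n.
  suff : x <= n - i.+1 by lia.
  apply: xmin; apply/orP; left; apply/negP.
  by rewrite subnKC // => /A_level; rewrite level_node // ltnn.
have [b outb] : exists b, node (turn b) (i.+1 + x) \notin A.
  by case/orP: outx; [exists false | exists true].
exists b, x; split=> //.
(* The first [x] vertices of both runs: the position determines the run and the level the depth, so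
   [f] is injective. *)
pose f (c : bool * 'I_x) := node (turn c.1) (i.+1 + c.2).
have lf c : level (f c) = (i.+1 + c.2).+1.
  by rewrite level_node //; have := ltn_ord c.2; lia.
have pf c : pos (f c) = pos s + c.1.
  by apply: pos_turn; have := ltn_ord c.2; lia.
have f_inj : injective f.
  move=> c d fcd; have := lf c; have := pf c; rewrite fcd lf pf.
  case: c d {fcd} => [c1 c2] [d1 d2] /= /addnI + [/addnI cd].
  by rewrite (val_inj cd); case: c1 d1 => [] [].
have <- : #|f @: setT| = x.*2.
  by rewrite card_imset // cardsT card_prod card_bool card_ord mul2n.
rewrite -cardsUI.
have -> : below (i.+1 + x).+1 A :&: f @: setT = set0.
  apply/setP => v; rewrite !inE; apply/negP => /andP[/andP[_ lv]].
  by case/imsetP => c _ vE; move: lv; rewrite vE lf ltnS ltn_add2l ltnNge ltnW.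
rewrite cards0 addn0 subset_leq_card //; apply/subsetP => v.
rewrite !inE => /orP[/andP[-> /=]|/imsetP[c _ ->]]; first lia.
(* A value of [f] outside [A] would contradict the minimality of [x]. *)
rewrite lf; apply/andP; split; last lia.
apply: contraLR (ltn_ord c.2) => fcA; rewrite -leqNgt; apply: xmin.
by case: c fcA => [[] y] /= fcA; rewrite /out fcA ?orbT.
Qed.

End Turn.

(** * Cost of a round and the adversary's play *)

Lemma answers_hidden_of T T' Q : {in Q, T =i T'} ->
  answers (G := Py n) (hidden_of T) Q = answers (hidden_of T') Q.
Proof.
move=> TT'; apply/setP => e; rewrite !inE.
by case: (boolP (src e \in Q)) => [/TT'|]; rewrite ?andbF // /step => ->.
Qed.

Lemma below_leq_add j A Q : #|below j (A :|: Q)| <= #|below j A| + #|Q|.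
Proof.
apply: leq_trans (leq_card_setU _ _); apply: subset_leq_card.
by apply/subsetP => v; rewrite !inE; case: (v \in Q); rewrite ?orbT ?orbF.
Qed.

Lemma below_setD1_lt_add j A Q u : u \in Q ->
  #|below j (A :|: Q :\ u)| < #|below j A| + #|Q|.
Proof.
by move=> uQ; rewrite (cardsD1 u Q) uQ addnCA add1n ltnS below_leq_add.
Qed.

(* The current vertex is [node T i], [A] contains the other asked vertices and
   [C] is [k + 1] times the number of rounds played. *)
Lemma adversary k (st : strategy (Py n) (py_vertex n)) r T i A C :
  legal k st -> i <= n ->
  (forall v, v \in T -> level v <= i) -> (forall v, v \in A -> level v <= n) ->
  node T i \notin A -> i.*2 + #|below i.+1 A| <= C ->
  (forall T', (forall v, (v \in A) || (level v <= i) -> (v \in T') = (v \in T)) ->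
    @is_hidden_sink (Py n) (hidden_of T') (output (hidden_of T') st) /\
    rounds (hidden_of T') st <= r) ->
  n.*2 <= C + r * k.+1.
Proof.
(* By [ok] the strategy must succeed for every [T'] agreeing with [T] on [A] and on levels up to
   [i]; all other answers are still open. For [i = n] the claim follows from [iC]. *)
elim: st r T i A C => [w|Q next IH] r T i A C lst + T_level A_level sA iC ok;
  rewrite leq_eqVlt => /predU1P[in_|iN]; try by move: iC; rewrite in_; lia.
  (* Stopping with [i < n] fails: both turns are still open and lead to sinks in adjacent
     columns. *)
  have ls : level (node T i) = i.+1 by rewrite level_node // ltnW.
  have wE b : w = node (turn T i b) n.
    apply: hidden_sink_node; apply: (ok _ _).1 => v vK; case: b => //=.
    rewrite !inE; case: eqP => // vs; move: vK.
    by rewrite vs (negbTE sA) ls ltnn.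
  have posw b := @pos_turn T i iN T_level b n.
  have := posw true; have := posw false.
  by rewrite -!wE iN leqnn => /(_ isT)-> /(_ isT)/addnI.
have ls : level (node T i) = i.+1 by rewrite level_node // ltnW.
change {set py_vertex n} in Q; have [cQ nQ lQ] := lst.
have {}cQ : #|Q| <= k := cQ.
have Q_level v : v \in Q -> level v <= n.
  by move=> /nQ; rewrite py_is_sink -leqNgt.
have r0 : 0 < r by apply: leq_trans (ok T _).2.
(* If the current vertex is not asked, it stays current and all of [Q] joins [A]. *)
have [sQ|sQ] := boolP (node T i \in Q); last first.
  suff : n.*2 <= (C + k.+1) + r.-1 * k.+1 by case: (r) r0 => //= r' _; nia.
  apply: (IH (answers (hidden_of T) Q) _ T i (A :|: Q)) => //.
  - exact: lQ.
  - exact: ltnW.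
  - by move=> v; rewrite inE => /orP[/A_level|/Q_level].
  - by rewrite inE negb_or sA.
  - by have := below_leq_add i.+1 A Q; lia.
  move=> T' T'P.
  have aE : answers (G := Py n) (hidden_of T') Q = answers (hidden_of T) Q.
    by apply: answers_hidden_of => v vQ; rewrite T'P // inE vQ orbT.
  have [|] := ok T'; last by rewrite -aE /= => ? ?; split; last lia.
  by move=> v vK; apply: T'P; rewrite inE; case/orP: vK => ->; rewrite ?orbT.
pose A' := A :|: Q :\ node T i.
have A'_level v : v \in A' -> level v <= n.
  by rewrite !inE => /orP[/A_level|/andP[_ /Q_level]].
have [b [x [xn outx cx]]] := turn_exists iN T_level A'_level.
suff : n.*2 <= (C + k.+1) + r.-1 * k.+1 by case: (r) r0 => //= r' _; nia.
apply: (IH (answers (hidden_of (turn T i b)) Q) _ (turn T i b) (i.+1 + x) A') => //.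
- exact: lQ.
- by move=> v /(level_turn iN T_level); lia.
(* Twice the descent adds [2 + 2 * x], the other questions add at most [k - 1], and [2 * x] asked
   vertices drop out: [k + 1] in total. *)
- by have := below_setD1_lt_add i.+1 A sQ; rewrite -/A'; lia.
move=> T' T'P.
have aE : answers (G := Py n) (hidden_of T') Q =
    answers (hidden_of (turn T i b)) Q.
  apply: answers_hidden_of => v vQ; apply: T'P; rewrite !inE vQ andbT.
  by case: eqP => [->|_]; rewrite ?orbT // ls; lia.
have [|] := ok T'; last by rewrite -aE /= => ? ?; split; last lia.
(* [turn] can alter [T] only at the current vertex, which is neither in [A] nor on a level up to
   [i]. *)
move=> v vK; rewrite T'P.
  case: b {outx aE T'P} => //=; rewrite !inE; case: eqP => // vs.
  by move: vK; rewrite vs (negbTE sA) ls ltnn.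
by rewrite inE; case/orP: vK => [->//|lv]; apply/orP; right; lia.
Qed.

Lemma si_Py_ge k (hk : 0 < k) : n.*2 <= si k hk (Py n) * k.+1.
Proof.
rewrite /si; case: ex_minnP => r /boolp.asboolP[st lst ok] _.
(* At the start the source is current, nothing has been asked and [C = 0]. *)
rewrite -[leqRHS]add0n; apply: (adversary (T := set0) (i := 0) (A := set0) lst) => //.
- by move=> v; rewrite inE.
- by move=> v; rewrite inE.
- by rewrite inE.
- by rewrite leqn0 cards_eq0; apply/eqP/setP => v; rewrite !inE.
by move=> T' _; apply: ok; apply: hidden_hidden_of.
Qed.

End Adversary.

Theorem theorem4 (k n : nat) (hk : (0 < k)%N) (hn : (0 < n)%N) :
  (si k hk (Py n) <= pa k hk (Py n))%N /\
  (Num.ceil (2 / (k%:R + 1) * n%:R : rat) <= Posz (si k hk (Py n)))%R.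
Proof.
split; first exact: si_le_pa.
have := si_Py_ge n hk; move: (si _ _ _) => r.
rewrite -mul2n -(Num.Theory.ler_nat rat) !GRing.natrM -(GRing.natr1 _ k) => le.
have k0 : (0 < k%:R + 1 :> rat)%R by rewrite GRing.natr1 Num.Theory.ltr0n.
by rewrite Num.Theory.ceil_le_int GRing.mulrAC Num.Theory.ler_pdivrMr.
Qed.
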